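(* Let $(\mathfrak g,\pi_0,\pi_1)$ be a post-Lie algebra (with Lie bracket $\pi_0$ and product $\pi_1=\rhd$), and let $\pi'_0:\mathfrak g\wedge\mathfrak g\to \mathfrak g$ and $\pi'_1:\mathfrak g\otimes\mathfrak g\to \mathfrak g$ be linear maps. Then $(\mathfrak g,\pi_0+\pi'_0,\pi_1+\pi'_1)$ is a post-Lie algebra if and only if $\pi'=(\pi_0',\pi_1')$ is a Maurer-Cartan element of the differential graded Lie algebra $(C_{\mathsf{PL}}^*(\mathfrak g,\mathfrak g),[\cdot,\cdot]_{\mathsf{PL}},d_\pi)$, i.e. $d_\pi\pi'+\tfrac12[\pi',\pi']_{\mathsf{PL}}=0$, where $\pi=(\pi_0,\pi_1)$ and $d_\pi=[\pi,\cdot]_{\mathsf{PL}}$.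
   Context: The ground field $\mathbf k$ has characteristic zero. A post-Lie algebra $(\mathfrak g,[\cdot,\cdot]_{\mathfrak g},\rhd)$ is a Lie algebra $(\mathfrak g,[\cdot,\cdot]_{\mathfrak g})$ with a bilinear product $\rhd:\mathfrak g\otimes\mathfrak g\to\mathfrak g$ such that $x\rhd[y,z]_{\mathfrak g}=[x\rhd y,z]_{\mathfrak g}+[y,x\rhd z]_{\mathfrak g}$ and $([x,y]_{\mathfrak g}+x\rhd y-y\rhd x)\rhd z=x\rhd(y\rhd z)-y\rhd(x\rhd z)$ for all $x,y,z\in\mathfrak g$. For a vector space $V$ put $C_{\mathsf{PL}}^{n}(V,V)=\bigoplus_{i=0}^{n}\mathrm{Hom}(\wedge^{i}V\otimes \wedge^{n+1-i}V,V)$, $n\ge 0$, $C^*_{\mathsf{PL}}(V,V)=\bigoplus_{n\ge0}C_{\mathsf{PL}}^{n}(V,V)$, and write $f=(f_0,\dots,f_n)$ with $f_i\in \mathrm{Hom}(\wedge^iV\otimes\wedge^{n+1-i}V,V)$. Products in exterior powers are written by juxtaposition. $\mathbb S_{(i_1,\dots,i_k)}$ denotes the set of $(i_1,\dots,i_k)$-shuffles (empty if some $i_r<0$) and $(-1)^\sigma$ the sign of $\sigma$. $C^*_{\mathsf{PL}}(V,V)$ is a graded Lie algebra with bracket $[f,g]_{\mathsf{PL}}=f\circ g-(-1)^{nm}g\circ f$ for $f\in C_{\mathsf{PL}}^{n}(V,V)$, $g\in C_{\mathsf{PL}}^{m}(V,V)$, where $f\circ g=((f\circ g)_0,\dots,(f\circ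 g)_{n+m})\in C^{n+m}_{\mathsf{PL}}(V,V)$ is defined as follows. For $0\le k\le m$, $$\begin{aligned}&(f\circ g)_k(x_1 \cdots x_{k}\otimes x_{k+1} \cdots x_{n+m+1})=\sum_{0\le j\le k}\ \sum_{\sigma\in\mathbb S_{(k-j,j)}}\ \sum_{\tau\in\mathbb S_{(m+1-j,n+j-k)}}(-1)^\sigma(-1)^\tau(-1)^{m(k-j)}\\ &f_{k-j}\big(x_{\sigma(1)} \cdots x_{\sigma(k-j)}\otimes g_{j}(x_{\sigma(k-j+1)} \cdots x_{\sigma(k)}\otimes x_{k+\tau(1)} \cdots x_{k+\tau(m+1-j)})\, x_{k+\tau(m+2-j)} \cdots x_{k+\tau(n+m+1-k)}\big),\end{aligned}$$ and for $m+1\le k\le m+n$, $$\begin{aligned}&(f\circ g)_{k}(x_1 \cdots x_k\otimes x_{k+1} \cdots x_{n+m+1})\\ =&\sum_{0\le j\le m}\ \sum_{\sigma\in \mathbb S_{(j,m+1-j,k-m-1)}}(-1)^{\sigma}f_{k-m}\big(g_{j}(x_{\sigma(1)} \cdots x_{\sigma(j)}\otimes x_{\sigma(j+1)} \cdots x_{\sigma(m+1)})\, x_{\sigma(m+2)} \cdots x_{\sigma(k)}\otimes x_{k+1} \cdots x_{n+m+1}\big)\\ &+\sum_{0\le j\le m}\ \sum_{\sigma\in\mathbb S_{(k-j,j)}}\ \sum_{\tau\in\mathbb S_{(m+1-j,n+j-k)}}(-1)^\sigma(-1)^\tau(-1)^{m(k-j)}\\ &f_{k-j}\big(x_{\sigma(1)}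 \cdots x_{\sigma(k-j)}\otimes g_{j}(x_{\sigma(k-j+1)} \cdots x_{\sigma(k)}\otimes x_{k+\tau(1)} \cdots x_{k+\tau(m+1-j)})\, x_{k+\tau(m+2-j)} \cdots x_{k+\tau(n+m+1-k)}\big).\end{aligned}$$ For a post-Lie algebra, $\pi=(\pi_0,\pi_1)\in C^1_{\mathsf{PL}}(\mathfrak g,\mathfrak g)$ satisfies $[\pi,\pi]_{\mathsf{PL}}=0$, so that $d_\pi=[\pi,\cdot]_{\mathsf{PL}}$ is a differential. *)

(* Defs.v *)
From HB Require Import structures.
From mathcomp Require Import all_boot all_order all_fingroup all_algebra.
Set Implicit Arguments.
Unset Strict Implicit.
Unset Printing Implicit Defensive.
Import GRing.Theory.
Local Open Scope ring_scope.

Section PostLieAlgebra.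
Variables (K : fieldType) (V : lmodType K).
Implicit Types br rhd : V -> V -> V.

(* Linear maps V (x) V -> V and V /\ V -> V, seen on pairs of vectors. *)
Definition bilinear_map rhd : Prop := bilinear_for *:%R *:%R rhd.

Definition alt_bilinear_map br : Prop :=
  bilinear_map br /\ forall x, br x x = 0.

Record is_lie br : Prop := IsLie {
  lie_alt_bilinear : alt_bilinear_map br;
  lie_jacobi : forall x y z,
    br (br x y) z + br (br y z) x + br (br z x) y = 0
}.

Record is_postlie br rhd : Prop := IsPostLie {
  postlie_lie : is_lie br;
  postlie_bilinear : bilinear_map rhd;
  postlie_derivation : forall x y z,
    rhd x (br y z) = br (rhd x y) z + br y (rhd x z);
  postlie_curvature : forall x y z,
    rhd (br x y + rhd x y - rhd y x) z = rhd x (rhd y z) - rhd y (rhd x z)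
}.

End PostLieAlgebra.

Section Cochains.
Variables (K : fieldType) (V : lmodType K).

Definition upd a (x : a.-tuple V) (p : 'I_a) (v : V) : a.-tuple V :=
  [tuple if q == p then v else tnth x q | q < a].

Definition multilinear a (h : a.-tuple V -> V) : Prop :=
  forall (x : a.-tuple V) (p : 'I_a), linear (fun v => h (upd x p v)).

Definition alternating a (h : a.-tuple V -> V) : Prop :=
  forall (x : a.-tuple V) (p q : 'I_a),
    p != q -> tnth x p = tnth x q -> h x = 0.

(* Families (f_0, ..., f_n) of arbitrary functions
   V^i x V^(n+1-i) -> V; the formula for f o g makes sense for all of them.  *)
Definition cochain n : Type :=
  forall i : 'I_n.+1, i.-tuple V -> (n.+1 - i).-tuple V -> V.

(* C_PL^n(V,V) inside cochain n: by the universal property of exterior powers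
   and tensor products, Hom(/\^i V (x) /\^j V, V) is the space of functions
   V^i x V^j -> V that are multilinear and alternating in each group of
   variables.  *)
Definition is_PL_cochain n (f : cochain n) : Prop :=
  forall i : 'I_n.+1,
    (forall y, multilinear (f i ^~ y) /\ alternating (f i ^~ y)) /\
    (forall x, multilinear (f i x) /\ alternating (f i x)).

(* The s-shuffles in 'S_N: the sequence sigma(0), ..., sigma(N-1) is cut into
   consecutive blocks of lengths given by s, each of which is increasing.  *)
Definition shuffles N (s : seq nat) : {set 'S_N} :=
  [set sigma : 'S_N | (sumn s == N) &&
     all (sorted ltn) (reshape s [seq val (sigma p) | p <- enum 'I_N])].

Definition permute N (sigma : 'S_N) (x : N.-tuple V) : seq V :=
  [seq tnth x (sigma p) | p <- enum 'I_N].

(* The first b entries of s, as a b-tuple. It is only ever used on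
   sequences of length at least b, so the default value 0 is never read.  *)
Definition tup b (s : seq V) : b.-tuple V := [tuple s`_i | i < b].

(* The part of (f o g)_k where g is inserted in the second group of arguments
   of f. The formula is the same for k <= m and for k > m: j ranges over
   0 <= j <= min(k, m). Since n + j - k would be truncated in nat, the terms
   with n + j < k, where the set of (m+1-j, n+j-k)-shuffles is empty, are
   explicitly excluded; this also gives k - j <= n, so that inord (k - j)
   has value k - j.  *)
Definition circ_right n m (f : cochain n) (g : cochain m) : cochain (n + m) :=
  fun k x y =>
  \sum_(j < m.+1 | (j <= k <= n + j)%N)
  \sum_(sigma in @shuffles k [:: k - j; j : nat]%N)
  \sum_(tau in @shuffles ((n + m).+1 - k) [:: m.+1 - j; n + j - k]%N)
    let xs := permute sigma x in
    let ys := permute tau y in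
    ((-1) ^+ sigma * (-1) ^+ tau * (-1) ^+ (m * (k - j))) *:
    f (inord (k - j)) (tup _ xs)
      (tup _ (g j (tup _ (drop (k - j) xs)) (tup _ ys) :: drop (m.+1 - j) ys)).

(* The part where g is inserted in the first group; it occurs for k > m. *)
Definition circ_left n m (f : cochain n) (g : cochain m) : cochain (n + m) :=
  fun k x y =>
  if (m < k)%N then
    \sum_(j < m.+1)
    \sum_(sigma in @shuffles k [:: j : nat; m.+1 - j; k - m.+1]%N)
      let xs := permute sigma x in
      (-1) ^+ sigma *:
      f (inord (k - m))
        (tup _ (g j (tup _ xs) (tup _ (drop j xs)) :: drop m.+1 xs))
        (tup _ y)
  else 0.

Definition circ n m (f : cochain n) (g : cochain m) : cochain (n + m) :=
  fun k x y => circ_left f g x y + circ_right f g x y.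

Definition bracketPL n m (f : cochain n) (g : cochain m) : cochain (n + m) :=
  fun k x y =>
    circ f g x y
    - (-1) ^+ (n * m) *: (ecast N (cochain N) (addnC m n) (circ g f)) k x y.

Definition dPL m (pi : cochain 1) (f : cochain m) : cochain (1 + m) :=
  bracketPL pi f.

Definition maurer_cartan (pi f : cochain 1) : Prop :=
  is_PL_cochain f /\
  forall (k : 'I_3) (x : k.-tuple V) (y : (3 - k).-tuple V),
    dPL pi f x y + 2%:R^-1 *: bracketPL f f x y = 0.

(* (pi_0, pi_1), with pi_0 in Hom(/\^0 V (x) /\^2 V, V)
   and pi_1 in Hom(/\^1 V (x) /\^1 V, V).  *)
Definition cochain1 (p0 p1 : V -> V -> V) : cochain 1 :=
  fun i x y => if i == ord0 then p0 y`_0 y`_1 else p1 x`_0 y`_0.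

End Cochains.

(* Main.v *)
(* Write P = (P_0, P_1). Running through the shuffles of at most three letters,
   the three components of P o P are the Jacobiator of P_0, the failure of P_1 to
   act by derivations of P_0, and the failure of the curvature identity; hence P
   is post-Lie iff P o P = 0. The product o is bilinear, so for P = pi + pi' and
   pi o pi = 0,
     P o P = pi o pi' + pi' o pi + pi' o pi' = d_pi pi' + 1/2 [pi', pi'],
   as both brackets of degree 1 elements are anticommutators. *)
Require Import Defs.
From HB Require Import structures.
From mathcomp Require Import all_boot all_order all_fingroup all_algebra.
Import GRing.Theory.
Local Open Scope ring_scope.

(** * Shuffles with one block, or with a last block of length one *)

(** A strictly increasing list is determined by its set of values, and the values of a permutation
    are all of ['I_N]. *)
Lemma sorted_perm N (sigma : 'S_N) :
  sorted ltn [seq val (sigma p) | p <- enum 'I_N] = (sigma == 1%g).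
Proof.
apply/idP/eqP => [srt|->]; last first.
  by under eq_map do rewrite perm1; rewrite val_enum_ord iota_ltn_sorted.
have eqs : [seq val (sigma p) | p <- enum 'I_N] = [seq val p | p <- enum 'I_N].
  rewrite val_enum_ord; apply: (irr_sorted_eq ltn_trans ltnn srt (iota_ltn_sorted 0 N)) => i.
  rewrite mem_iota add0n leq0n /=; apply/mapP/idP => [[p _ ->] //|ltiN].
  by exists ((sigma^-1)%g (Ordinal ltiN)); rewrite ?mem_enum ?permKV.
apply/permP => p; rewrite perm1; apply: val_inj.
by move/eq_in_map: eqs => /(_ p); apply; rewrite mem_enum.
Qed.

(** An empty block imposes no order condition and adds nothing to the length. This removes the zero
    entries from the shuffle types met in [circ]. *)
Lemma shuffles_filter N s : @shuffles N s = shuffles N [seq i <- s | i != 0%N].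
Proof.
apply/setP => sigma; rewrite !inE; congr (_ && _).
  by congr (_ == _); elim: s => //= -[|i] s /= ->.
by elim: s [seq _ | p <- _] => //= -[|i] s IHs l /=; rewrite IHs ?take0 ?drop0.
Qed.

Lemma shuffles_single N : @shuffles N [:: N] = [set 1%g].
Proof.
apply/setP => sigma; rewrite !inE /= addn0 eqxx andbT /= take_oversize.
  exact: sorted_perm.
by rewrite size_map size_enum_ord.
Qed.

Lemma shufflesn0 N : @shuffles N [:: N; 0]%N = [set 1%g].
Proof. by rewrite shuffles_filter -(shuffles_single N) (shuffles_filter N [:: N]). Qed.

Lemma shuffles0n N : @shuffles N [:: 0; N]%N = [set 1%g].
Proof. by rewrite shuffles_filter -(shuffles_single N) (shuffles_filter N [:: N]). Qed.

Lemma shuffles0n0 N : @shuffles N [:: 0; N; 0]%N = [set 1%g].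
Proof. by rewrite shuffles_filter -(shufflesn0 N) (shuffles_filter N [:: N; _]). Qed.

Lemma sorted_map_bump i s : sorted ltn s -> sorted ltn [seq bump i k | k <- s].
Proof. by apply: homo_sorted => j k /=; rewrite !ltnNge leq_bump2. Qed.

(** The inclusion of ['I_N] is written [lift ord_max] so that [lift_perm_lift] applies to the
    entries. *)
Lemma map_enum_ordSr T N (F : 'I_N.+1 -> T) :
  [seq F p | p <- enum 'I_N.+1] =
  rcons [seq F (lift ord_max p) | p <- enum 'I_N] (F ord_max).
Proof.
rewrite enum_ordSr map_rcons -map_comp; congr rcons.
by apply: eq_map => p /=; congr F; apply: val_inj; exact/esym/lift_max.
Qed.

Lemma mem_shufflesn1 N (sigma : 'S_N.+1) :
  (sigma \in shuffles N.+1 [:: N; 1%N]) =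
  sorted ltn [seq val (sigma (lift ord_max p)) | p <- enum 'I_N].
Proof.
rewrite inE /= addn1 eqxx map_enum_ordSr -cats1.
have sz : size [seq val (sigma (lift ord_max p)) | p <- enum 'I_N] = N.
  by rewrite size_map size_enum_ord.
by rewrite take_size_cat ?drop_size_cat /= ?andbT.
Qed.

(* Two (N, 1)-shuffles with the same last value have the same set of first N
   values, listed in increasing order by both. *)
Lemma shufflesn1 N :
  shuffles N.+1 [:: N; 1%N] = [set lift_perm ord_max i 1 | i : 'I_N.+1].
Proof.
have lift_srt (i : 'I_N.+1) :
    sorted ltn [seq val (lift_perm ord_max i 1 (lift ord_max p)) | p <- enum 'I_N].
  under eq_map do rewrite lift_perm_lift perm1.
  by rewrite (map_comp (bump i) val) val_enum_ord sorted_map_bump ?iota_ltn_sorted.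
apply/setP => sigma; apply/idP/imsetP => [|[i _ ->]]; last by rewrite mem_shufflesn1.
rewrite mem_shufflesn1 => srt; exists (sigma ord_max) => //.
have /eq_in_map eqs : [seq val (sigma (lift ord_max p)) | p <- enum 'I_N] =
    [seq val (lift_perm ord_max (sigma ord_max) 1 (lift ord_max p)) | p <- enum 'I_N].
  apply: (irr_sorted_eq ltn_trans ltnn srt (lift_srt _)) => v.
  (* Both sets of values are the complement of [sigma ord_max]: on each side, injectivity keeps the
     other positions away from this value. *)
  apply/mapP/mapP => -[k _ ->].
    have /unlift_some[l defl _] : sigma ord_max != sigma (lift ord_max k).
      by rewrite (inj_eq perm_inj) neq_lift.
    by exists l; rewrite ?mem_enum // lift_perm_lift perm1 -defl.
  have /unlift_some[l defl _] : ord_max != (sigma^-1)%g (lift (sigma ord_max) k).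
    by rewrite -(inj_eq (@perm_inj _ sigma)) permKV neq_lift.
  by exists l; rewrite ?mem_enum // -defl permKV lift_perm_lift perm1.
apply/permP => q; case: (unliftP ord_max q) => [p ->|->]; last by rewrite lift_perm_id.
by apply: val_inj; apply: eqs; rewrite mem_enum.
Qed.

(** The index [i] is recovered as the image of [ord_max], so no shuffle is counted twice. The sign
    of the [i]-th one is the parity of [N + i]. *)
Lemma big_shufflesn1 (V : nmodType) N (F : 'S_N.+1 -> V) :
  \sum_(sigma in shuffles N.+1 [:: N; 1%N]) F sigma =
  \sum_(i < N.+1) F (lift_perm ord_max i 1).
Proof.
rewrite shufflesn1 big_imset //= => i j _ _ eq_ij.
by rewrite -(lift_perm_id ord_max i 1) eq_ij lift_perm_id.
Qed.

(** * The three components of a composition of cochains of degree 1 *)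

Section PostLie.
Context {K : fieldType} {V : lmodType K}.
Implicit Types p q r a b : V -> V -> V.

Lemma permute1 N (x : N.-tuple V) : permute 1 x = x.
Proof.
rewrite /permute -[RHS](map_tnth_enum x).
by apply: eq_map => i; rewrite perm1.
Qed.

Lemma nth_permute_lift N (x : N.+1.-tuple V) (i : 'I_N.+1) j : (j <= N)%N ->
  (permute (lift_perm ord_max i 1) x)`_j = x`_(if (j < N)%N then bump i j else i).
Proof.
rewrite /permute map_enum_ordSr nth_rcons size_map size_enum_ord => lejN.
case: ltnP => [ltjN | leNj]; last first.
  by rewrite eqn_leq lejN leNj lift_perm_id (tnth_nth 0).
rewrite (nth_map (Ordinal ltjN)) ?size_enum_ord //.
by rewrite (nth_ord_enum _ (Ordinal ltjN)) lift_perm_lift perm1 (tnth_nth 0).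
Qed.

Lemma nth_tup n (s : seq V) i : (i < n)%N -> (tup n s)`_i = s`_i.
Proof. by move=> ltin; rewrite -(tnth_nth 0 _ (Ordinal ltin)) tnth_mktuple. Qed.

(** [cochain1] reads only entries that [tup] keeps, so the truncations in [circ] can be
    forgotten. *)
Lemma cochain1_tup p q (i : 'I_2) xs ys :
  @cochain1 K V p q i (tup i xs) (tup (2 - i) ys) =
  if i == 0%N :> nat then p ys`_0 ys`_1 else q xs`_0 ys`_0.
Proof. by case: i => [[|[|//]] lti]; rewrite /cochain1 /= !nth_tup. Qed.

(** Only [j = 0] contributes, through the three (2, 1)-shuffles of [y]. Stating the value of [k] as
    an equation avoids casts between the tuple types that depend on [k]. *)
Lemma circ_cochain1_0 p q a b (k : 'I_3) (x : k.-tuple V) (y : (3 - k).-tuple V) :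
    k = 0%N :> nat ->
  circ (cochain1 p q) (cochain1 a b) x y =
  p (a y`_1 y`_2) y`_0 - p (a y`_0 y`_2) y`_1 + p (a y`_0 y`_1) y`_2.
Proof.
case: k x y => [[|//] lti] x y _.
rewrite /circ /circ_left /circ_right /= add0r.
rewrite big_mkcond !big_ord_recl big_ord0 /= !addr0.
rewrite (shufflesn0 0) big_set1 (big_shufflesn1 _ 2) !big_ord_recl big_ord0 /=.
rewrite !odd_lift_perm !odd_perm1 /= !cochain1_tup ?inordK //=.
rewrite !nth_drop !nth_permute_lift //= /bump /=.
by rewrite !(expr0, expr1, mul1r, mulr1, scale1r, scaleN1r, addr0, addrA).
Qed.

(** The two terms in [p] come from [j = 1] and the (1, 1)-shuffles of [y]. The term in [q] comes
    from [j = 0], where the factor [(-1) ^+ (m * (k - j))] is -1. *)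
Lemma circ_cochain1_1 p q a b (k : 'I_3) (x : k.-tuple V) (y : (3 - k).-tuple V) :
    k = 1%N :> nat ->
  circ (cochain1 p q) (cochain1 a b) x y =
  p (b x`_0 y`_0) y`_1 - p (b x`_0 y`_1) y`_0 - q x`_0 (a y`_0 y`_1).
Proof.
case: k x y => [[|[|//]] lti] // x y _.
rewrite /circ /circ_left /circ_right /= add0r.
rewrite big_mkcond !big_ord_recl big_ord0 /= !addr0.
rewrite (shufflesn0 1) (shuffles0n 1) !big_set1 (shufflesn0 2) big_set1.
rewrite (big_shufflesn1 _ 1) !big_ord_recl big_ord0 /=.
rewrite !odd_lift_perm !odd_perm1 /= !cochain1_tup ?inordK //=.
rewrite !nth_drop !nth_permute_lift //= /bump /= !permute1.
rewrite !(addn0, add0n, subn0, subnn, mul1n, expr0, expr1).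
rewrite !(mul1r, mulr1, mulrN1, opprK, scale1r, scaleN1r, addr0).
by rewrite [LHS]addrC [X in X + _ = _]addrC.
Qed.

(** The first three terms are [circ_left], with [j = 0] for [a] and [j = 1] for [b]. The last two
    are [circ_right], where only [j = 1] is admissible and the degree sign is -1. *)
Lemma circ_cochain1_2 p q a b (k : 'I_3) (x : k.-tuple V) (y : (3 - k).-tuple V) :
    k = 2%N :> nat ->
  circ (cochain1 p q) (cochain1 a b) x y =
  q (a x`_0 x`_1) y`_0 + (q (b x`_0 x`_1) y`_0 - q (b x`_1 x`_0) y`_0)
  - (q x`_0 (b x`_1 y`_0) - q x`_1 (b x`_0 y`_0)).
Proof.
case: k x y => [[|[|[|//]]] lti] // x y _.
rewrite /circ /circ_left /circ_right /=.
rewrite [X in _ + X]big_mkcond !big_ord_recl !big_ord0 /= !addr0.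
rewrite (shuffles0n0 2) !big_set1 (shuffles_filter 2 [:: 1; 1; 0]%N).
rewrite (shufflesn0 1).
(* Here [tau] can only be the identity; exchanging the sums brings it outside, where it is
   eliminated. *)
rewrite [X in _ + X]add0r exchange_big /= big_set1.
rewrite !(big_shufflesn1 _ 1) !big_ord_recl !big_ord0 /=.
rewrite !odd_lift_perm !odd_perm1 /= !cochain1_tup ?inordK //=.
rewrite !nth_drop !nth_permute_lift //= /bump /= !permute1.
rewrite !(addn0, add0n, subn0, subnn, mul1n, expr0, expr1).
rewrite !(mul1r, mulr1, mulrN1, opprK, scale1r, scaleN1r, addr0) opprB.
by congr (_ + _ + _); rewrite addrC.
Qed.

(** * Bilinear and alternating maps, and the cochains they define *)

Lemma bilinearDl {q} (qlin : bilinear_map q) u v w : q (u + v) w = q u w + q v w.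
Proof. by rewrite -[u]scale1r qlin.1 /= !scale1r. Qed.

Lemma bilinearDr {q} (qlin : bilinear_map q) u v w : q u (v + w) = q u v + q u w.
Proof. by rewrite -[v]scale1r qlin.2 /= !scale1r. Qed.

Lemma bilinearNl {q} (qlin : bilinear_map q) u v : q (- u) v = - q u v.
Proof.
apply/eqP; rewrite -addr_eq0 -(bilinearDl qlin) addNr.
by apply/eqP/(@addrI _ (q 0 v)); rewrite -(bilinearDl qlin) !addr0.
Qed.

Lemma alt_bilinearC {p} (palt : alt_bilinear_map p) u v : p u v = - p v u.
Proof.
case: palt => plin palt; apply/eqP; rewrite -addr_eq0; apply/eqP.
have := palt (u + v).
by rewrite (bilinearDl plin) !(bilinearDr plin) !palt add0r addr0.
Qed.

Lemma bilinear_mapD {q r} : bilinear_map q -> bilinear_map r ->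
  bilinear_map (fun x y => q x y + r x y).
Proof.
move=> qlin rlin; split=> [w c u v|u c v w] /=.
  by rewrite qlin.1 rlin.1 /= scalerDr addrACA.
by rewrite qlin.2 rlin.2 /= scalerDr addrACA.
Qed.

Lemma alt_bilinear_mapD {q r} : alt_bilinear_map q -> alt_bilinear_map r ->
  alt_bilinear_map (fun x y => q x y + r x y).
Proof.
move=> [qlin qalt] [rlin ralt]; split; first exact: bilinear_mapD.
by move=> x; rewrite qalt ralt addr0.
Qed.

Lemma nth_upd n (x : n.-tuple V) (s : 'I_n) v i : (i < n)%N ->
  (upd x s v)`_i = if i == s then v else x`_i.
Proof.
move=> ltin; rewrite -(tnth_nth 0 _ (Ordinal ltin)) tnth_mktuple.
by rewrite (tnth_nth 0) -val_eqE.
Qed.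

Lemma alternating1 (h : 1.-tuple V -> V) : alternating h.
Proof. by move=> x s t; rewrite !ord1. Qed.

Lemma cochain1_is_PL {p q} :
  alt_bilinear_map p -> bilinear_map q -> is_PL_cochain (cochain1 p q).
Proof.
move=> [plin palt] qlin [[|[|//]] lti]; split=> [y|x]; split.
(* For [i = 0] the first group has no positions, so both conditions on it are vacuous. *)
- by move=> ? [].
- by move=> ? [].
- move=> y s c u v; rewrite /cochain1 /= !nth_upd //.
  by case: s => [[|[|//]] ?] /=; rewrite (plin.1, plin.2).
- move=> y s t neq_st; rewrite !(tnth_nth 0) => eq_st.
  suff : y`_0 = y`_1 by rewrite /cochain1 /= => ->.
  by case: s t neq_st eq_st => [[|[|//]] ?] [[|[|//]] ?].
- by move=> x s c u v; rewrite /cochain1 /= !nth_upd // ord1 qlin.1.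
- exact: alternating1.
- by move=> y s c u v; rewrite /cochain1 /= !nth_upd // ord1 qlin.2.
exact: alternating1.
Qed.

(** * Biadditivity of the composition *)

(** The left factor occurs once, outermost, in every term, so only a regrouping of sums remains. *)
Lemma circ_cochain1Dl p p' q q' a b
    (k : 'I_3) (x : k.-tuple V) (y : (3 - k).-tuple V) :
  circ (cochain1 (fun u v => p u v + p' u v) (fun u v => q u v + q' u v))
    (cochain1 a b) x y =
  circ (cochain1 p q) (cochain1 a b) x y
  + circ (cochain1 p' q') (cochain1 a b) x y.
Proof.
have [k0|[k1|k2]] : k = 0%N :> nat \/ k = 1%N :> nat \/ k = 2%N :> nat.
  by case: k {x y} => [[|[|[|//]]] ?] /=; auto.
- by rewrite !circ_cochain1_0 // [RHS]addrACA [X in _ = X + _]addrACA -opprD.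
- rewrite !circ_cochain1_1 // [RHS]addrACA [X in _ = X + _]addrACA.
  by rewrite -!opprD.
rewrite !circ_cochain1_2 // [RHS]addrACA [X in _ = X + _]addrACA -opprD.
by rewrite !(addrACA _ (- _)) -!opprD.
Qed.

(** The right factor sits inside an argument of [p] or [q], whose additivity in that argument splits
    each term. *)
Lemma circ_cochain1Dr p q a a' b b'
    (k : 'I_3) (x : k.-tuple V) (y : (3 - k).-tuple V) :
    bilinear_map p -> bilinear_map q ->
  circ (cochain1 p q)
    (cochain1 (fun u v => a u v + a' u v) (fun u v => b u v + b' u v)) x y =
  circ (cochain1 p q) (cochain1 a b) x y
  + circ (cochain1 p q) (cochain1 a' b') x y.
Proof.
move=> plin qlin.
have [k0|[k1|k2]] : k = 0%N :> nat \/ k = 1%N :> nat \/ k = 2%N :> nat.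
  by case: k {x y} => [[|[|[|//]]] ?] /=; auto.
- rewrite !circ_cochain1_0 // !(bilinearDl plin).
  by rewrite [RHS]addrACA [X in _ = X + _]addrACA -opprD.
- rewrite !circ_cochain1_1 // !(bilinearDl plin) (bilinearDr qlin).
  by rewrite [RHS]addrACA [X in _ = X + _]addrACA -!opprD.
rewrite !circ_cochain1_2 // !(bilinearDl qlin) !(bilinearDr qlin).
rewrite [RHS]addrACA [X in _ = X + _]addrACA -opprD.
by rewrite !(addrACA _ (- _)) -!opprD.
Qed.

(** * From post-Lie structures to the Maurer-Cartan equation *)

(** Antisymmetry of [p] turns the shuffle order of the terms into the cyclic order of the Jacobi
    identity and into the Leibniz rule; additivity of [q] on the left assembles the curvature
    term. *)
Lemma postlie_circ0 {p q} : alt_bilinear_map p -> bilinear_map q ->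
  is_postlie p q <->
  forall (k : 'I_3) (x : k.-tuple V) (y : (3 - k).-tuple V),
    circ (cochain1 p q) (cochain1 p q) x y = 0.
Proof.
move=> palt qlin; have plin := palt.1; split=> [[[_ jac] _ der curv] k x y|circ0].
  have [k0|[k1|k2]] : k = 0%N :> nat \/ k = 1%N :> nat \/ k = 2%N :> nat.
    by case: k {x y} => [[|[|[|//]]] ?] /=; auto.
  - rewrite circ_cochain1_0 // -[RHS](jac y`_0 y`_1 y`_2) addrC addrA.
    by rewrite [p y`_2 y`_0](alt_bilinearC palt) bilinearNl.
  - rewrite circ_cochain1_1 // der.
    by rewrite [p y`_0 (q _ _)](alt_bilinearC palt) subrr.
  - by rewrite circ_cochain1_2 // -curv !(bilinearDl qlin) (bilinearNl qlin) addrA subrr.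
(* Conversely, each axiom at [x], [y], [z] is read off from the component [k] whose first group
   takes the first [k] of these vectors. *)
split=> // [||x y z].
- split=> // x y z; have := circ0 ord0 [tuple] [tuple x; y; z].
  rewrite circ_cochain1_0 //= addrC addrA.
  by rewrite [p z x](alt_bilinearC palt) bilinearNl.
- move=> x y z; have := circ0 (Ordinal (isT : 1 < 3)%N) [tuple x] [tuple y; z].
  rewrite circ_cochain1_1 //= => /eqP; rewrite subr_eq0 => /eqP <-.
  by rewrite [p y (q _ _)](alt_bilinearC palt).
have := circ0 (Ordinal (isT : 2 < 3)%N) [tuple x; y] [tuple z].
rewrite circ_cochain1_2 //= => /eqP; rewrite subr_eq0 => /eqP <-.
by rewrite !(bilinearDl qlin) (bilinearNl qlin) addrA.
Qed.

(** The cast is along a proof of [1 + 1 = 1 + 1], hence trivial by uniqueness of identity proofs on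
    [nat]; the sign [- (-1) ^+ 1] is +1. *)
Lemma bracketPL11 (f g : cochain V 1) (k : 'I_3) (x : k.-tuple V) (y : (3 - k).-tuple V) :
  bracketPL f g x y = circ f g x y + circ g f x y.
Proof. by rewrite /bracketPL (eq_axiomK (addnC 1 1)) /= expr1 scaleN1r opprK. Qed.

End PostLie.

Theorem theorem2p18 (K : fieldType) (charK0 : [pchar K] =i pred0)
    (V : lmodType K) (pi0 pi1 : V -> V -> V) (Hpi : is_postlie pi0 pi1)
    (pi0' pi1' : V -> V -> V)
    (Hpi0' : alt_bilinear_map pi0') (Hpi1' : bilinear_map pi1') :
  is_postlie (fun x y => pi0 x y + pi0' x y) (fun x y => pi1 x y + pi1' x y)
  <-> maurer_cartan (cochain1 pi0 pi1) (cochain1 pi0' pi1').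
Proof.
have [[Hpi0 _] Hpi1 _ _] := Hpi; have [pi0_lin _] := Hpi0; have [pi0'_lin _] := Hpi0'.
have circ_pi := (postlie_circ0 Hpi0 Hpi1).1 Hpi.
apply: (iff_trans (postlie_circ0 (alt_bilinear_mapD Hpi0 Hpi0') (bilinear_mapD Hpi1 Hpi1'))).
(* It suffices to identify the Maurer-Cartan expression with the self-composition of the sum,
   component by component. *)
suff mcE (k : 'I_3) (x : k.-tuple V) (y : (3 - k).-tuple V) :
    dPL (cochain1 pi0 pi1) (cochain1 pi0' pi1') x y
      + 2%:R^-1 *: bracketPL (cochain1 pi0' pi1') (cochain1 pi0' pi1') x y =
    circ (cochain1 (fun x y => pi0 x y + pi0' x y) (fun x y => pi1 x y + pi1' x y))
      (cochain1 (fun x y => pi0 x y + pi0' x y) (fun x y => pi1 x y + pi1' x y)) x y.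
  split=> [circ0|[_ mc] k x y]; last by rewrite -mcE.
  by split=> [|k x y]; [exact: cochain1_is_PL | rewrite mcE].
(* Characteristic zero makes 2 invertible, so half of the bracket of the perturbation with itself is
   its self-composition. *)
have two_neq0 : 2%:R != 0 :> K by rewrite (pcharf0P K).1.
rewrite /dPL !bracketPL11 -mulr2n -scaler_nat scalerA mulVf // scale1r.
rewrite circ_cochain1Dl !circ_cochain1Dr ?circ_pi ?add0r ?addrA //.
Qed.
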